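(* Let $Q\succeq0$, $q\in\mathbb{R}^n$, $A\succ0$, $v\in\mathbb{R}^n$, and let $m>0$ satisfy Requirement 2. Let $x_1\in\mathcal{C}$ and define $x_{k+1}=x_k-\gamma_k\nabla J_k(x_k)$ for $k\in\mathbb{N}$, where the step sizes satisfy $0<\gamma_k\le 1/L_k$ for all $k$, $\sum_{k=1}^\infty\gamma_k^2<\infty$ and $\sum_{k=1}^\infty\gamma_k=\infty$. Then for any minimizer $x^\star\in\mathcal{X}^\star$ of the constrained problem, $f(x_k)\to f(x^\star)$ as $k\to\infty$.
   Context: $Q\in\mathbb{R}^{n\times n}$ symmetric positive semidefinite, $A\in\mathbb{R}^{n\times n}$ symmetric positive definite. $f(x)=\tfrac12 x^\top Qx+q^\top x$, $g(x)=(x-v)^\top A(x-v)$, $\mathcal{C}=\{x:g(x)\le1\}$, $\partial\mathcal{C}=\{x:g(x)=1\}$, $\mathcal{X}^\star=\arg\min_{x\in\mathcal{C}}f(x)$. $J_k(x)=f(x)+\frac{m}{k}g(x)^k$ for $k\in\mathbb{N}=\{1,2,\dots\}$, $L_k=\bar\sigma(Q+m(4k-2)A)$, with $\bar\sigma,\underline\sigma$ the largest/smallest singular value; $r=\sqrt{\underline\sigma(A)}/\bar\sigma(A)$. Requirement 2: with $w(x)=\nabla f(x)+m\nabla g(x)$, for every $x\in\partial\mathcal{C}$, $\|w(x)\|^2\|\nabla g(x)\|\le 2rL_1\langle w(x),\nabla g(x)\rangle$ (i.e. $\|w(x)\|\le 2rL_1\cos\phi(x)$ with $\phi(x)$ the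 angle between $w(x)$ and $\nabla g(x)$). *)

(* Defs.v *)
From HB Require Import structures.
From mathcomp Require Import all_boot all_order all_algebra.
From mathcomp Require Import all_classical all_reals all_analysis.
Set Implicit Arguments. Unset Strict Implicit. Unset Printing Implicit Defensive.
Import Order.TTheory GRing.Theory Num.Theory.
Local Open Scope classical_set_scope.
Local Open Scope ring_scope.

Section Defs.
Variables (R : realType) (n : nat).

Definition dotv (u w : 'cV[R]_n) : R := (u^T *m w) 0 0.
Definition vnorm (u : 'cV[R]_n) : R := Num.sqrt (dotv u u).

Definition symmetric_mx (M : 'M[R]_n) : Prop := M^T = M.
Definition psd_mx (M : 'M[R]_n) : Prop :=
  symmetric_mx M /\ forall x : 'cV[R]_n, 0 <= dotv x (M *m x).
Definition pd_mx (M : 'M[R]_n) : Prop :=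
  symmetric_mx M /\ forall x : 'cV[R]_n, x != 0 -> 0 < dotv x (M *m x).

Definition sigma_max (M : 'M[R]_n) : R :=
  sup [set vnorm (M *m x) | x in [set x : 'cV[R]_n | vnorm x = 1]].
Definition sigma_min (M : 'M[R]_n) : R :=
  inf [set vnorm (M *m x) | x in [set x : 'cV[R]_n | vnorm x = 1]].

Variables (Q A : 'M[R]_n) (q v : 'cV[R]_n) (m : R).

Definition fobj (x : 'cV[R]_n) : R := 2^-1 * dotv x (Q *m x) + dotv q x.
Definition gcon (x : 'cV[R]_n) : R := dotv (x - v) (A *m (x - v)).
Definition Jpen (k : nat) (x : 'cV[R]_n) : R := fobj x + m / k%:R * gcon x ^+ k.

(* gradients (Q, A symmetric): grad f = Q x + q, grad g = 2 A (x - v),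
   grad J_k = grad f + m g^(k-1) grad g *)
Definition grad_f (x : 'cV[R]_n) : 'cV[R]_n := Q *m x + q.
Definition grad_g (x : 'cV[R]_n) : 'cV[R]_n := 2 *: (A *m (x - v)).
Definition grad_J (k : nat) (x : 'cV[R]_n) : 'cV[R]_n :=
  grad_f x + (m * gcon x ^+ k.-1) *: grad_g x.

Definition Lk (k : nat) : R := sigma_max (Q + (m * (4 * k - 2)%:R) *: A).
Definition rA : R := Num.sqrt (sigma_min A) / sigma_max A.

Definition requirement2 : Prop :=
  forall x : 'cV[R]_n, gcon x = 1 ->
    let w := grad_f x + m *: grad_g x in
    vnorm w ^+ 2 * vnorm (grad_g x) <= 2 * rA * Lk 1 * dotv w (grad_g x).

Definition is_minimizer (xs : 'cV[R]_n) : Prop :=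
  gcon xs <= 1 /\ forall y, gcon y <= 1 -> fobj xs <= fobj y.

End Defs.

(* Main.v *)
Require Import Defs.
From HB Require Import structures.
From mathcomp Require Import all_boot all_order all_algebra.
From mathcomp Require Import all_classical all_reals all_analysis.
From mathcomp Require Import ring lra.
Import Order.TTheory GRing.Theory Num.Theory numFieldNormedType.Exports.
Local Open Scope classical_set_scope.
Local Open Scope ring_scope.

(** Feasibility of the iterates.  On the boundary, Requirement 2 says that a step
    of length at most [1 / L_1] stays in the ellipsoid [g <= 1].  For an interior
    point [x], the step map [T] is monotone on the ellipsoid because [J_k] is
    [L_k]-smooth there; moving from [x] along [u = A (T x - v)] to the boundary
    point [y] gives [g (T x) = <T x - v, u> <= <T y - v, u>], and Cauchy-Schwarz
    for [A] together with [g (T y) <= 1] yields [g (T x) <= 1].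

    Convergence.  Convexity and [t^(k-1) (1 - t) <= 1/k] on [0, 1] give
    [<grad J_k(x), x - x*> >= f(x) - f(x* ) - m/k], so expanding
    [|x_(k+1) - x*|^2] shows that [gamma_k (f(x_k) - f(x* ))] is summable.  As the
    gaps are nonnegative and grow by at most [O(gamma_k)] per step, they tend
    to [0]. *)

(** * Inner product, norm and extreme singular values on column vectors *)

Section EuclideanSpace.
Context {R : realType} {n : nat}.
Implicit Types (x y z u w : 'cV[R]_n) (M : 'M[R]_n) (c : R).

Lemma dotvC x y : dotv x y = dotv y x.
Proof. by rewrite /dotv -[in LHS](trmxK y) -trmx_mul mxE. Qed.

Lemma dotvDr x y z : dotv x (y + z) = dotv x y + dotv x z.
Proof. by rewrite /dotv mulmxDr mxE. Qed.

Lemma dotvZr c x y : dotv x (c *: y) = c * dotv x y.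
Proof. by rewrite /dotv -scalemxAr mxE. Qed.

Lemma dotvNr x y : dotv x (- y) = - dotv x y.
Proof. by rewrite /dotv mulmxN mxE. Qed.

Lemma dotvDl x y z : dotv (x + y) z = dotv x z + dotv y z.
Proof. by rewrite !(dotvC _ z) dotvDr. Qed.

Lemma dotvZl c x y : dotv (c *: x) y = c * dotv x y.
Proof. by rewrite !(dotvC _ y) dotvZr. Qed.

Lemma dotvNl x y : dotv (- x) y = - dotv x y.
Proof. by rewrite !(dotvC _ y) dotvNr. Qed.

Lemma dotv0 x : dotv x 0 = 0.
Proof. by rewrite /dotv mulmx0 mxE. Qed.

Definition dotvE := (dotvDl, dotvDr, dotvZl, dotvZr, dotvNl, dotvNr).

Lemma dotv_symmetric M x y :
  symmetric_mx M -> dotv x (M *m y) = dotv y (M *m x).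
Proof. by move=> sM; rewrite dotvC /dotv trmx_mul sM mulmxA. Qed.

Lemma dotv_sum x y : dotv x y = \sum_i x i 0 * y i 0.
Proof. by rewrite /dotv mxE; apply: eq_bigr => i _; rewrite mxE. Qed.

Lemma dotv_ge0 x : 0 <= dotv x x.
Proof. by rewrite dotv_sum sumr_ge0 // => i _; rewrite -expr2 sqr_ge0. Qed.

Lemma dotv_eq0 x : dotv x x = 0 -> x = 0.
Proof.
rewrite dotv_sum => /eqP; rewrite psumr_eq0; last first.
  by move=> i _; rewrite -expr2 sqr_ge0.
move=> /allP h; apply/matrixP => i j; rewrite (ord1 j) mxE.
have := h i (mem_index_enum i); rewrite /= -expr2 sqrf_eq0.
by move/eqP.
Qed.

Lemma vnorm_ge0 x : 0 <= vnorm x. Proof. exact: sqrtr_ge0. Qed.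

Lemma sqr_vnorm x : vnorm x ^+ 2 = dotv x x.
Proof. by rewrite sqr_sqrtr ?dotv_ge0. Qed.

Lemma vnorm_eq0 x : vnorm x = 0 -> x = 0.
Proof. by move=> h; apply: dotv_eq0; rewrite -sqr_vnorm h expr0n. Qed.

Lemma vnormZ c x : vnorm (c *: x) = `|c| * vnorm x.
Proof. by rewrite /vnorm !dotvE mulrA -expr2 sqrtrM ?sqr_ge0// sqrtr_sqr. Qed.

Lemma vnormN x : vnorm (- x) = vnorm x.
Proof. by rewrite -scaleN1r vnormZ normrN1 mul1r. Qed.

Lemma psd_CauchySchwarz M x y : psd_mx M ->
  dotv x (M *m y) ^+ 2 <= dotv x (M *m x) * dotv y (M *m y).
Proof.
move=> [sM pM].
have form s t : 0 <= s ^+ 2 * dotv x (M *m x) + 2 * s * t * dotv x (M *m y)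
                     + t ^+ 2 * dotv y (M *m y).
  have := pM (s *: x + t *: y).
  rewrite mulmxDr -!scalemxAr !dotvE (dotv_symmetric _ y x sM); lra.
have a0 := pM x; have c0 := pM y.
set a := dotv x (M *m x) in form a0 *; set c := dotv y (M *m y) in form c0 *.
set b := dotv x (M *m y) in form *.
(* The choice [s = c], [t = - b] makes the form equal to [c * (a * c - b ^+ 2)], and the other case
   is symmetric. If [a] and [c] both vanish, [s = 1], [t = - b] leaves [- 2 * b ^+ 2], which forces
   [b = 0]. *)
have [cp|c1] := ltP 0 c.
  have h := form c (- b); rewrite -(ler_pM2l cp); lra.
have [ap|a1] := ltP 0 a.
  have h := form (- b) a; rewrite -(ler_pM2l ap); lra.
have -> : a = 0 by lra.
have h := form 1 (- b); have := sqr_ge0 b; nra.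
Qed.

Lemma psd_mx1 : psd_mx (1%:M : 'M[R]_n).
Proof.
by split=> [|x]; [rewrite /symmetric_mx trmx1|rewrite mul1mx dotv_ge0].
Qed.

Lemma dotv_le_vnorm x y : dotv x y <= vnorm x * vnorm y.
Proof.
have := psd_CauchySchwarz 1%:M x y psd_mx1; rewrite !mul1mx -!sqr_vnorm -exprMn.
have h : 0 <= vnorm x * vnorm y by rewrite mulr_ge0 ?vnorm_ge0.
have [d0 _|d0] := leP (dotv x y) 0; first exact: le_trans h.
by rewrite ler_pXn2r ?nnegrE// ltW.
Qed.

Lemma vnormD x y : vnorm (x + y) <= vnorm x + vnorm y.
Proof.
have h : 0 <= vnorm x + vnorm y by rewrite addr_ge0 ?vnorm_ge0.
rewrite -(@ler_pXn2r _ 2) ?nnegrE ?vnorm_ge0// sqr_vnorm !dotvE (dotvC y x).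
have := dotv_le_vnorm x y; rewrite -!sqr_vnorm; lra.
Qed.

(** Cauchy-Schwarz on each row gives the squared Frobenius norm [S] as a bound for the squares;
    [1 + S] is positive and its square dominates [S]. This makes the supremum in [sigma_max] one of
    a bounded set, hence a true upper bound. *)
Lemma vnorm_mulmx_bounded M :
  exists2 K : R, 0 < K & forall x, vnorm (M *m x) <= K * vnorm x.
Proof.
pose S := \sum_i vnorm (row i M)^T ^+ 2.
have S0 : 0 <= S by apply: sumr_ge0 => i _; exact: sqr_ge0.
exists (1 + S) => [|x]; first by lra.
rewrite -(@ler_pXn2r _ 2) ?nnegrE ?vnorm_ge0 ?mulr_ge0 ?vnorm_ge0//; last by lra.
rewrite sqr_vnorm dotv_sum exprMn.
have le1 : \sum_i (M *m x) i 0 * (M *m x) i 0 <= S * vnorm x ^+ 2.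
  rewrite mulr_suml; apply: ler_sum => i _.
  have -> : (M *m x) i 0 = dotv (row i M)^T x by rewrite /dotv trmxK -row_mul [RHS]mxE.
  have := psd_CauchySchwarz 1%:M (row i M)^T x psd_mx1.
  by rewrite !mul1mx -!sqr_vnorm -expr2.
apply: le_trans le1 _; rewrite ler_wpM2r ?sqr_ge0//; nra.
Qed.

Lemma vnorm_le_sigma_max M x : vnorm (M *m x) <= sigma_max M * vnorm x.
Proof.
have [->|x0] := eqVneq x 0; first by rewrite mulmx0 /vnorm !dotv0 sqrtr0 mulr0.
have nx : 0 < vnorm x.
  rewrite lt_neqAle vnorm_ge0 andbT eq_sym; apply: contra_neq x0; exact: vnorm_eq0.
rewrite -ler_pdivrMr// mulrC -[_^-1]ger0_norm ?invr_ge0 ?vnorm_ge0//.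
rewrite -vnormZ scalemxAr.
have unitx : vnorm ((vnorm x)^-1 *: x) = 1.
  by rewrite vnormZ ger0_norm ?invr_ge0 ?vnorm_ge0// mulVf ?gt_eqF.
apply: ub_le_sup; last by exists ((vnorm x)^-1 *: x).
have [K _ hK] := vnorm_mulmx_bounded M; exists K => _ [y /= y1 <-].
by rewrite -[K]mulr1 -y1.
Qed.

Lemma sigma_min_le_vnorm M x : sigma_min M * vnorm x <= vnorm (M *m x).
Proof.
have [->|x0] := eqVneq x 0; first by rewrite mulmx0 /vnorm !dotv0 sqrtr0 mulr0.
have nx : 0 < vnorm x.
  rewrite lt_neqAle vnorm_ge0 andbT eq_sym; apply: contra_neq x0; exact: vnorm_eq0.
rewrite -ler_pdivlMr// mulrC -[_^-1]ger0_norm ?invr_ge0 ?vnorm_ge0//.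
rewrite -vnormZ scalemxAr.
have unitx : vnorm ((vnorm x)^-1 *: x) = 1.
  by rewrite vnormZ ger0_norm ?invr_ge0 ?vnorm_ge0// mulVf ?gt_eqF.
apply: ge_inf; last by exists ((vnorm x)^-1 *: x).
by exists 0 => _ [y /= _ <-]; exact: vnorm_ge0.
Qed.

Lemma form_le_sigma_max M x : dotv x (M *m x) <= sigma_max M * vnorm x ^+ 2.
Proof.
apply: (le_trans (dotv_le_vnorm _ _)).
rewrite expr2 mulrCA ler_wpM2l ?vnorm_ge0//; exact: vnorm_le_sigma_max.
Qed.

(** Cauchy-Schwarz for the form of [M] at [x] and [M *m x] bounds [|M x|^4] by [s^2 |x|^2 |M x|^2].
    This passes from quadratic forms to norms without eigenvalues. *)
Lemma psd_vnorm_le M s : psd_mx M -> 0 <= s ->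
  (forall z, dotv z (M *m z) <= s * vnorm z ^+ 2) ->
  forall x, vnorm (M *m x) <= s * vnorm x.
Proof.
move=> pM s0 hs x.
have /= h := psd_CauchySchwarz M x (M *m x) pM.
rewrite (dotv_symmetric _ _ _ pM.1) -sqr_vnorm in h.
have N0 := vnorm_ge0 (M *m x).
have h2 : dotv x (M *m x) * dotv (M *m x) (M *m (M *m x)) <=
  (s * vnorm x ^+ 2) * (s * vnorm (M *m x) ^+ 2) by rewrite ler_pM ?hs//; exact: pM.2.
have [|Np] := leP (vnorm (M *m x)) 0.
  by move=> N1; apply: (le_trans N1); rewrite mulr_ge0 ?vnorm_ge0.
rewrite -(@ler_pXn2r _ 2) ?nnegrE ?mulr_ge0 ?vnorm_ge0//.
have Np2 : 0 < vnorm (M *m x) ^+ 2 by rewrite exprn_gt0.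
rewrite -(ler_pM2r Np2).
move: (le_trans h h2); lra.
Qed.

Lemma pd_psd M : pd_mx M -> psd_mx M.
Proof.
move=> [sM pM]; split=> // x; have [->|/pM/ltW//] := eqVneq x 0.
by rewrite mulmx0 dotv0.
Qed.

Lemma pd_unitmx M : pd_mx M -> M \in unitmx.
Proof.
move=> [sM pM]; rewrite -row_free_unit -kermx_eq0; apply/eqP/row_matrixP => i.
rewrite row0; apply/trmx_inj; rewrite trmx0; apply/eqP; apply: contraT => /pM.
by rewrite -[M in M *m _]sM -trmx_mul -row_mul mulmx_ker row0 trmx0 dotv0 ltxx.
Qed.

(** With [z = M^-1 x], Cauchy-Schwarz for [M] gives [|x|^4 <= <x, M x> <z, x>], and
    [<z, x> <= K |x|^2] for any norm bound [K] of the inverse. No compactness of the sphere is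
    involved. *)
Lemma pd_coercive M : pd_mx M ->
  exists2 K : R, 0 < K & forall x, vnorm x ^+ 2 <= K * dotv x (M *m x).
Proof.
move=> pM; have uM := pd_unitmx M pM.
have [K K0 hK] := vnorm_mulmx_bounded (invmx M).
exists K => // x; set z := invmx M *m x.
have Mz : M *m z = x by rewrite mulKVmx.
have := psd_CauchySchwarz M x z (pd_psd M pM).
rewrite Mz -sqr_vnorm => h.
have q0 : 0 <= dotv x (M *m x) by exact: (pd_psd M pM).2.
have [x0|xp] := leP (vnorm x) 0.
  by rewrite (_ : vnorm x = 0) ?expr0n ?mulr_ge0 ?(ltW K0)//; have := vnorm_ge0 x; lra.
have h2 : dotv z x <= vnorm x * (K * vnorm x).
  rewrite dotvC; apply: (le_trans (dotv_le_vnorm _ _)).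
  by rewrite ler_wpM2l ?vnorm_ge0//; exact: hK.
have xp2 : 0 < vnorm x ^+ 2 by rewrite exprn_gt0.
rewrite -(ler_pM2r xp2).
have := ler_wpM2l q0 h2; lra.
Qed.

Lemma exists_unit_vector : (0 < n)%N -> exists e : 'cV[R]_n, vnorm e = 1.
Proof.
move=> n0; exists (delta_mx (Ordinal n0) 0).
rewrite /vnorm dotv_sum (bigD1 (Ordinal n0)) //= !mxE eqxx.
rewrite big1 ?addr0 ?mul1r ?sqrtr1// => i /negbTE h.
by rewrite !mxE h mul0r.
Qed.

(** Monotonicity in the Loewner order, used to compare [L_1] with [L_k]. A positive dimension makes
    the unit sphere nonempty. *)
Lemma sigma_max_le (M N : 'M[R]_n) : (0 < n)%N -> psd_mx M ->
  (forall z, dotv z (M *m z) <= dotv z (N *m z)) -> sigma_max M <= sigma_max N.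
Proof.
move=> n0 pM MN; have [e e1] := exists_unit_vector n0.
have N0 : 0 <= sigma_max N.
  by apply: (le_trans (vnorm_ge0 (N *m e))); rewrite -[leRHS]mulr1 -e1 vnorm_le_sigma_max.
apply: ge_sup; first by exists (vnorm (M *m e)), e.
move=> _ [y /= y1 <-]; rewrite -[leRHS]mulr1 -y1; apply: psd_vnorm_le => // z.
exact: le_trans (MN z) (form_le_sigma_max _ _).
Qed.

Lemma pd_sigma_min_gt0 M : (0 < n)%N -> pd_mx M -> 0 < sigma_min M.
Proof.
move=> n0 pM; have [K K0 hK] := pd_coercive M pM.
apply: (@lt_le_trans _ _ K^-1); first by rewrite invr_gt0.
apply: lb_le_inf.
  by have [e e1] := exists_unit_vector n0; exists (vnorm (M *m e)), e.
move=> _ [y /= y1 <-]; rewrite -div1r ler_pdivrMr//.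
have := hK y; rewrite y1 expr1n => h; apply: (le_trans h).
rewrite mulrC ler_wpM2r ?(ltW K0)//.
by apply: (le_trans (dotv_le_vnorm _ _)); rewrite y1 mul1r.
Qed.

Lemma sigma_min_form_le M x : 0 < sigma_min M ->
  sigma_min M * dotv x (M *m x) <= vnorm (M *m x) ^+ 2.
Proof.
move=> s0; have h1 := dotv_le_vnorm x (M *m x); have h2 := sigma_min_le_vnorm M x.
have N0 := vnorm_ge0 (M *m x).
apply: (le_trans (ler_wpM2l (ltW s0) h1)).
by rewrite mulrA expr2 ler_wpM2r.
Qed.

End EuclideanSpace.

(** * Real sequences and power inequalities on the unit interval *)

Section Sequences.
Context {R : realType}.
Implicit Types (a s t gamma : nat -> R).

(* The squares satisfy [a k.+1 ^+ 2 - a k ^+ 2 <= 2 C gamma k a k + C^2 gamma k ^+ 2],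
   which is summable, while divergence of the step sizes forces [a] to be small
   infinitely often. *)
Lemma cvg0_of_summable_steps a gamma (C B D : R) :
  0 <= C ->
  (forall k, (1 <= k)%N -> 0 <= a k) ->
  (forall k, (1 <= k)%N -> 0 <= gamma k) ->
  (forall k, (1 <= k)%N -> a k.+1 <= a k + C * gamma k) ->
  (forall N, \sum_(1 <= k < N) gamma k ^+ 2 <= B) ->
  (forall N, \sum_(1 <= k < N) gamma k * a k <= D) ->
  (fun N => \sum_(1 <= k < N) gamma k) @ \oo --> +oo ->
  a @ \oo --> 0.
Proof.
move=> C0 a0 g0 aS hB hD div.
pose e k := 2 * C * (gamma k * a k) + C ^+ 2 * gamma k ^+ 2.
have e0 k : (1 <= k)%N -> 0 <= e k.
  by move=> k1; rewrite addr_ge0 ?mulr_ge0 ?sqr_ge0 ?a0 ?g0.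
pose s N := \sum_(1 <= k < N.+1) e k.
have sS N : s N.+1 = s N + e N.+1 by rewrite /s big_nat_recr.
have s_ub N : s N <= 2 * C * D + C ^+ 2 * B.
  rewrite /s big_split /= -!mulr_sumr lerD// ler_wpM2l ?mulr_ge0 ?sqr_ge0 ?hD ?hB//.
have s_nd : nondecreasing_seq s.
  by apply/nondecreasing_seqP => N; rewrite sS lerDl e0.
have s_cvg : cvgn s.
  by apply: nondecreasing_is_cvgn => //; exists (2 * C * D + C ^+ 2 * B) => _ [N _ <-].
have sq_step k : a k.+2 ^+ 2 <= a k.+1 ^+ 2 + (s k.+1 - s k).
  rewrite sS /e; have := aS k.+1 isT; have := a0 k.+1 isT; have := a0 k.+2 isT.
  have := g0 k.+1 isT; move: (a k.+2) (a k.+1) (gamma k.+1) => a2 a1 g gp p2 p1 h.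
  have cg := mulr_ge0 C0 gp.
  have : a2 ^+ 2 <= (a1 + C * g) ^+ 2 by rewrite ler_pXn2r ?nnegrE//; lra.
  lra.
have sq_tail k j : a (k + j).+1 ^+ 2 <= a k.+1 ^+ 2 + (s (k + j)%N - s k).
  elim: j => [|j IH]; first by rewrite addn0; lra.
  by rewrite addnS; have := sq_step (k + j)%N; lra.
apply/cvgrPdist_lt => eps eps0.
(* A value below [eps / 2] has square below [eps ^+ 2 / 4]; a later growth of the square by less
   than [d] keeps it below [eps ^+ 2]. *)
pose d := eps ^+ 2 / 4.
have d0 : 0 < d by rewrite divr_gt0 ?exprn_gt0.
have [N _ hN] : \forall N \near \oo, `|limn s - s N| < d.
  by move/cvgrPdist_lt: s_cvg; apply.
have tailN k j : (N <= k)%N -> s (k + j)%N - s k < d.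
  move=> Nk; have := hN k Nk.
  have := nondecreasing_cvgn_le s_nd s_cvg k.
  have := nondecreasing_cvgn_le s_nd s_cvg (k + j)%N.
  by move=> h1 h2; rewrite ger0_norm; lra.
(* Otherwise [a] stays at least [eps / 2] beyond [N], and the divergence of the step sizes pushes
   the weighted sum above [D]. *)
have [k Nk ak] : exists2 k, (N <= k)%N & a k.+1 < eps / 2.
  apply: contrapT => hno.
  have big k : (N <= k)%N -> eps / 2 <= a k.+1.
    by move=> Nk; rewrite leNgt; apply/negP => h; apply: hno; exists k.
  have low j : eps / 2 * (\sum_(1 <= k < (N + j).+1) gamma k
       - \sum_(1 <= k < N.+1) gamma k)
     <= \sum_(1 <= k < (N + j).+1) gamma k * a k - \sum_(1 <= k < N.+1) gamma k * a k.
    elim: j => [|j IH]; first by rewrite addn0; lra.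
    rewrite addnS !(big_nat_recr (N + j).+1)//=.
    have := ler_wpM2l (g0 (N + j).+1 isT) (big (N + j)%N (leq_addr _ _)); lra.
  set G := \sum_(1 <= k < N.+1) gamma k in low.
  set H := \sum_(1 <= k < N.+1) gamma k * a k in low.
  move/cvgryPgt: div => /(_ (G + (D - H) / (eps / 2))) [M _ hM].
  have := hM (N + M).+1; rewrite /= leqW ?leq_addl// => /(_ isT).
  have := low M; have := hD (N + M).+1.
  move: (\sum_(1 <= k < _) gamma k * a k) (\sum_(1 <= k < _) gamma k) => X Y hX h.
  rewrite -ltrBrDl ltr_pdivrMr; last by lra.
  lra.
exists k.+1 => //= j kj; rewrite sub0r normrN.
have j1 : (0 < j)%N by exact: leq_ltn_trans kj.
rewrite ger0_norm ?a0// -(@ltr_pXn2r _ 2) ?nnegrE ?a0 ?(ltW eps0)//.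
have -> : j = (k + (j - k.+1)).+1 by rewrite -addSn subnKC.
have := sq_tail k (j - k.+1)%N; have := tailN k (j - k.+1)%N Nk.
have : a k.+1 ^+ 2 < (eps / 2) ^+ 2.
  by rewrite ltr_pXn2r ?nnegrE ?a0//; lra.
move: d0; rewrite /d; lra.
Qed.

Lemma sum_inv_sqr_le2 (N : nat) : \sum_(1 <= k < N) k%:R^-1 ^+ 2 <= 2 :> R.
Proof.
(* The bound is strengthened so that the induction closes by [1/(t+1)^2 <= 1/t - 1/(t+1)]. *)
suff h n : \sum_(1 <= k < n.+2) k%:R^-1 ^+ 2 <= 2 - n.+1%:R^-1 :> R.
  case: N => [|[|n]]; [by rewrite big_geq|by rewrite big_geq|].
  by apply: (le_trans (h n)); rewrite lerBlDr lerDl invr_ge0.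
elim: n => [|n IH]; first by rewrite big_nat1 invr1 expr1n; lra.
rewrite big_nat_recr//=; apply: (le_trans (lerD IH (lexx _))).
have -> : n.+2%:R = n.+1%:R + 1 :> R by rewrite -natr1.
have : 0 < n.+1%:R :> R by rewrite ltr0n.
move: n.+1%:R => t t0.
rewrite -subr_ge0.
have -> : 2 - (t + 1)^-1 - (2 - t^-1 + (t + 1)^-1 ^+ 2) = t^-1 * (t + 1)^-1 ^+ 2.
  by field; rewrite ?lt0r_neq0//; lra.
by rewrite mulr_ge0 ?invr_ge0 ?sqr_ge0// ltW.
Qed.

Lemma exprn_gap_le (k : nat) (t : R) : 0 <= t <= 1 ->
  t ^+ k * (1 - t) <= k.+1%:R^-1.
Proof.
move=> /andP[t0 t1].
(* The right side is [1 - t] times a geometric sum of [k.+1] terms, each at least [t ^+ k]. *)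
have h : k.+1%:R * t ^+ k * (1 - t) <= 1 - t ^+ k.+1.
  elim: k => [|k IH]; first by rewrite expr0 expr1; lra.
  have h1 := ler_wpM2l t0 IH.
  have h2 : 0 <= (1 - t) * (1 - t ^+ k.+1).
    by rewrite mulr_ge0 ?subr_ge0 ?exprn_ile1.
  move: h1 h2; rewrite -natr1 !exprS; lra.
rewrite -div1r ler_pdivlMr ?ltr0n// mulrC mulrA; apply: (le_trans h).
by have := exprn_ge0 k.+1 t0; lra.
Qed.

(** The difference of powers factors as [s - t] times [k] terms in [0, 1]. Multiplying by [s - t]
    avoids a case split on its sign. *)
Lemma exprn_lipschitz (k : nat) (s t : R) : 0 <= s <= 1 -> 0 <= t <= 1 ->
  (s ^+ k - t ^+ k) * (s - t) <= k%:R * (s - t) ^+ 2.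
Proof.
move=> /andP[s0 s1] /andP[t0 t1].
rewrite subrXX mulrAC -expr2 mulrC ler_wpM2r ?sqr_ge0//.
rewrite -[k in k%:R]card_ord -sum1_card natr_sum ler_sum// => i _.
by rewrite mulr_ile1 ?exprn_ge0 ?exprn_ile1.
Qed.

End Sequences.

(** * Smoothness of the penalized objective on the ellipsoid *)

Section PenalizedGradient.
Context {R : realType} {n : nat}.
Variables (Q A : 'M[R]_n) (q v : 'cV[R]_n) (m : R).
Hypotheses (psdQ : psd_mx Q) (pdA : pd_mx A) (m_gt0 : 0 < m).
Let psdA : psd_mx A := pd_psd A pdA.

Local Notation f := (fobj Q q).
Local Notation g := (gcon A v).
Local Notation gradJ := (grad_J Q A q v m).
Local Notation L := (Lk Q A m).

Lemma gcon_ge0 x : 0 <= g x. Proof. exact: psdA.2. Qed.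

Lemma gcon_itv01 x : g x <= 1 -> 0 <= g x <= 1.
Proof. by rewrite gcon_ge0. Qed.

Lemma gcon_step c y w :
  g (y - c *: w) = g y - c * dotv w (grad_g A v y) + c * (c * dotv w (A *m w)).
Proof.
rewrite /grad_g /gcon addrAC; move: (y - v) => a.
rewrite mulmxBr -scalemxAr !dotvE (dotv_symmetric A a w psdA.1); lra.
Qed.

Lemma psd_Lk k : psd_mx (Q + (m * k%:R) *: A).
Proof.
have mk0 : 0 <= m * k%:R by rewrite mulr_ge0 // ltW.
split=> [|x]; first by rewrite /symmetric_mx linearD linearZ /= psdQ.1 psdA.1.
by rewrite mulmxDl -scalemxAl !dotvE addr_ge0 ?psdQ.2// mulr_ge0 ?psdA.2.
Qed.

Lemma Lk_form k z :
  dotv z (Q *m z) + m * (4 * k - 2)%:R * dotv z (A *m z) <= L k * vnorm z ^+ 2.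
Proof.
by rewrite -dotvZr -dotvDr scalemxAl -mulmxDl; exact: form_le_sigma_max.
Qed.

Lemma Lk1_le k : (0 < n)%N -> (1 <= k)%N -> L 1 <= L k.
Proof.
move=> n0 k1; apply: sigma_max_le => // [|z]; first exact: psd_Lk.
rewrite !mulmxDl -!scalemxAl !dotvE lerD2l ler_wpM2r ?psdA.2// ler_wpM2l ?(ltW m_gt0)//.
by rewrite ler_nat leq_sub2r// leq_mul2l.
Qed.

Lemma Lk1_gt0 : (0 < n)%N -> 0 < L 1.
Proof.
move=> n0; have [e e1] := @exists_unit_vector R n n0.
have e0 : e != 0.
  apply/eqP => e0; move: e1; rewrite e0 /vnorm dotv0 sqrtr0 => /esym/eqP.
  by rewrite oner_eq0.
have := Lk_form 1 e; rewrite e1 expr1n mulr1; move=> h; apply: (lt_le_trans _ h).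
by rewrite ltr_wpDl ?psdQ.2// mulr_gt0 ?pdA.2// mulr_gt0.
Qed.

(** This is the one-sided form of [L_k]-smoothness. The penalty part splits into a mean of the
    weights [g ^+ k.-1] times the squared [A]-distance, and a term from the difference of the
    weights. *)
Lemma grad_J_monotone k x y : (1 <= k)%N -> g x <= 1 -> g y <= 1 ->
  dotv (gradJ k y - gradJ k x) (y - x) <= L k * vnorm (y - x) ^+ 2.
Proof.
case: k => // p _ gx gy; apply: le_trans (Lk_form p.+1 (y - x)).
have /andP[a0 a1] := gcon_itv01 _ gy; have /andP[b0 b1] := gcon_itv01 _ gx.
have hp : 0 <= g x ^+ p <= 1 by rewrite exprn_ge0 ?exprn_ile1.
have hq : 0 <= g y ^+ p <= 1 by rewrite exprn_ge0 ?exprn_ile1.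
have lip := exprn_lipschitz p (g y) (g x) (gcon_itv01 _ gy) (gcon_itv01 _ gx).
have CS := psd_CauchySchwarz A ((y - v) - (x - v)) ((y - v) + (x - v)) psdA.
have d0 := psdA.2 ((y - v) - (x - v)).
have eD : y - x = (y - v) - (x - v) by rewrite opprB addrA subrK.
have eQ : dotv (grad_f Q q y - grad_f Q q x) (y - x) = dotv (y - x) (Q *m (y - x)).
  by rewrite dotvC /grad_f mulmxBr opprD addrACA subrr addr0.
have -> : (4 * p.+1 - 2)%:R = 4 * p%:R + 2 :> R.
  by rewrite mulnS addnC -addnBA// natrD natrM.
rewrite /grad_J /grad_g /= opprD addrACA [leLHS]dotvDl eQ lerD2l.
move: lip CS d0 a0 a1 b0 b1 hp hq; rewrite eD /gcon.
move: (y - v) (x - v) => a b.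
rewrite !(mulmxDr, mulmxN) !dotvE (dotv_symmetric A b a psdA.1).
rewrite ![dotv (A *m _) _]dotvC (dotv_symmetric A b a psdA.1).
set al := dotv a (A *m a); set be := dotv b (A *m b); set ga := dotv a (A *m b).
move: (al ^+ p) (be ^+ p) => P S lip CS d0 a0 a1 b0 b1 /andP[S0 S1] /andP[P0 P1].
pose d := al - 2 * ga + be.
have {}d0 : 0 <= d by move: d0; rewrite /d; lra.
(* Here [al - be] is the [A]-product of [a - b] and [a + b], and the parallelogram law bounds the
   form at [a + b] by 4. *)
have sq : (al - be) ^+ 2 <= 4 * d.
  have : (al - be) ^+ 2 <= d * (al + 2 * ga + be) by move: CS; rewrite /d; lra.
  have : 0 <= d * (4 - (al + 2 * ga + be)).
    by rewrite mulr_ge0//; move: d0; rewrite /d; lra.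
  lra.
have sq2 := ler_wpM2l (ler0n R p) sq.
have h1 : 0 <= (2 - P - S) * d by rewrite mulr_ge0//; lra.
(* The first term is at most [d] and the second at most [2 * p * d]. The factor [2 * m] of the
   penalty gradient then gives [m * (4 * p + 2)], the coefficient of [A] in [L_k] for [k = p.+1]. *)
have key : (P + S) / 2 * d + (P - S) * (al - be) / 2 <= (2 * p%:R + 1) * d by lra.
have := ler_wpM2l (ltW m_gt0) key; rewrite /d; lra.
Qed.

(** * Invariance of the ellipsoid under a gradient step *)

Hypothesis req2 : requirement2 Q A q v m.

Lemma gradient_step_boundary k gamma y : (0 < n)%N -> (1 <= k)%N ->
  0 < gamma -> gamma <= (L k)^-1 -> g y = 1 -> g (y - gamma *: gradJ k y) <= 1.
Proof.
move=> n0 k1 gam0 gamL gy.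
have -> : gradJ k y = grad_f Q q y + m *: grad_g A v y.
  by rewrite /grad_J gy expr1n mulr1.
have := req2 y gy; cbv zeta; set w := _ + _ => hw.
set X := dotv w (grad_g A v y) in hw.
have smin := pd_sigma_min_gt0 A n0 pdA.
have smax : 0 < sigma_max A.
  have [e e1] := @exists_unit_vector R n n0; apply: (lt_le_trans smin).
  have := le_trans (sigma_min_le_vnorm A e) (vnorm_le_sigma_max A e).
  by rewrite e1 !mulr1.
have L1 := Lk1_gt0 n0; have LL := Lk1_le k n0 k1.
have hg : 2 * Num.sqrt (sigma_min A) <= vnorm (grad_g A v y).
  rewrite /grad_g vnormZ ger0_norm// ler_wpM2l//.
  rewrite -(@ler_pXn2r _ 2) ?nnegrE ?vnorm_ge0 ?sqrtr_ge0// sqr_sqrtr ?(ltW smin)//.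
  by have := sigma_min_form_le A (y - v) smin; rewrite -/(gcon A v y) gy mulr1.
have s0 : 0 < Num.sqrt (sigma_min A) by rewrite sqrtr_gt0.
(* The lower bound on the norm of [grad_g] cancels the factor [2 * Num.sqrt (sigma_min A)]
   contributed by [rA] in Requirement 2. *)
have key : sigma_max A * vnorm w ^+ 2 <= L 1 * X.
  have := le_trans (ler_wpM2l (sqr_ge0 (vnorm w)) hg) hw.
  move=> /(ler_wpM2l (ltW smax)) h; rewrite -(ler_pM2l s0); move: h.
  have -> : sigma_max A * (2 * rA A * L 1 * X) = 2 * (Num.sqrt (sigma_min A) * (L 1 * X)).
    by rewrite /rA; field; rewrite lt0r_neq0.
  lra.
have X0 : 0 <= X.
  rewrite -(pmulr_rge0 _ L1); apply: le_trans key.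
  by rewrite mulr_ge0 ?sqr_ge0// ltW.
have gLX : gamma * (L 1 * X) <= X.
  have h1 : gamma * L k <= 1 by rewrite -ler_pdivlMr ?div1r// (lt_le_trans L1).
  have h2 := ler_wpM2r X0 h1; have h3 := ler_wpM2r X0 (ler_wpM2l (ltW gam0) LL); lra.
(* The quadratic term is at most [gamma * (gamma * (L 1 * X))], hence at most the linear decrease
   [gamma * X]. *)
have -> : g (y - gamma *: w) = 1 - gamma * X + gamma * (gamma * dotv w (A *m w)).
  by rewrite gcon_step gy.
have wAw := le_trans (form_le_sigma_max A w) key.
have h1 := le_trans (ler_wpM2l (ltW gam0) wAw) gLX.
have := ler_wpM2l (ltW gam0) h1; lra.
Qed.

Lemma gradient_step_feasible k gamma x : (0 < n)%N -> (1 <= k)%N ->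
  0 < gamma -> gamma <= (L k)^-1 -> g x <= 1 -> g (x - gamma *: gradJ k x) <= 1.
Proof.
move=> n0 k1 gam0 gamL gx.
have Lk0 : 0 < L k by exact: lt_le_trans (Lk1_gt0 n0) (Lk1_le k n0 k1).
have [gx1|gx1] := eqVneq (g x) 1; first exact: gradient_step_boundary.
have {gx1}gx1 : g x < 1 by rewrite lt_neqAle gx1.
set Tx := x - _.
pose u := A *m (Tx - v).
have [u0|u0] := eqVneq u 0; first by rewrite /gcon -/u u0 dotv0.
have c0 : 0 < dotv u (A *m u) by exact: pdA.2.
pose b := dotv u (A *m (x - v)); pose c := dotv u (A *m u).
have gline t : g (x + t *: u) = g x + 2 * t * b + t ^+ 2 * c.
  rewrite /gcon /b /c addrAC; move: (x - v) => a.
  rewrite mulmxDr -scalemxAr !dotvE (dotv_symmetric A a u psdA.1); lra.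
(* [D] is the reduced discriminant of [g (x + t *: u) = 1] in [t]. As [g x < 1], its square root
   exceeds [|b|], so the root [t] below is positive. *)
pose D := b ^+ 2 + c * (1 - g x).
have D0 : b ^+ 2 < D by rewrite ltrDl mulr_gt0// subr_gt0.
have sD : Num.sqrt D ^+ 2 = D.
  by rewrite sqr_sqrtr//; apply: le_trans (ltW D0); exact: sqr_ge0.
pose t := (Num.sqrt D - b) / c.
have t0 : 0 < t.
  rewrite divr_gt0// subr_gt0; apply: le_lt_trans (ler_norm b) _.
  by rewrite -sqrtr_sqr ltr_sqrt// (le_lt_trans (sqr_ge0 _) D0).
pose y := x + t *: u.
have gy : g y = 1.
  rewrite gline.
  have tc : t * c = Num.sqrt D - b by rewrite divfK// gt_eqF.
  apply: (mulfI (lt0r_neq0 c0)); rewrite -/c.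
  have -> : c * (g x + 2 * t * b + t ^+ 2 * c) = c * g x + 2 * (t * c) * b + (t * c) ^+ 2.
    by ring.
  rewrite tc sqrrB sD /D; lra.
have gTy := gradient_step_boundary k gamma y n0 k1 gam0 gamL gy.
set Ty := y - _ in gTy.
have yx : y - x = t *: u by rewrite /y addrAC subrr add0r.
(* The difference of the two sides, times [t], is at least [(1 - gamma * L k)] times the squared
   norm of [t *: u]. *)
have mono : dotv (Tx - v) u <= dotv (Ty - v) u.
  have eT : Ty - v - (Tx - v) = t *: u - gamma *: (gradJ k y - gradJ k x).
    rewrite -yx /Ty /Tx; move: (gradJ k y) (gradJ k x) => Gy Gx.
    by apply/matrixP => i j; rewrite !mxE; ring.
  have gy1 : g y <= 1 by rewrite gy.
  have := grad_J_monotone k x y k1 gx gy1.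
  rewrite -[dotv (Tx - v) u <= _]subr_ge0 -dotvNl -dotvDl eT sqr_vnorm yx.
  rewrite [dotv (_ - _) u]dotvDl dotvNl !(dotvZr, dotvZl).
  move: (dotv (gradJ k y - gradJ k x) u) => E.
  rewrite mulrCA ler_pM2l// => hE.
  have h1 : gamma * L k <= 1 by rewrite -ler_pdivlMr ?div1r.
  have := ler_wpM2l (ltW gam0) hE.
  have := ler_wpM2r (mulr_ge0 (ltW t0) (dotv_ge0 u)) h1; lra.
have := psd_CauchySchwarz A (Ty - v) (Tx - v) psdA.
rewrite -/u -/(gcon A v Tx) -/(gcon A v Ty) => CS.
rewrite -/u -/(gcon A v Tx) in mono.
have G0 := gcon_ge0 Tx.
have h1 := ler_wpM2r G0 gTy.
(* The bounds combine to [g Tx ^+ 2 <= g Ty * g Tx <= g Tx], impossible when [g Tx > 1]. *)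
rewrite leNgt; apply/negP => G1; nra.
Qed.

End PenalizedGradient.

(** * Convexity estimates and gradient bounds uniform in the penalty exponent *)

Section Convergence.
Context {R : realType} {n : nat}.
Variables (Q A : 'M[R]_n) (q v : 'cV[R]_n) (m : R).
Hypotheses (psdQ : psd_mx Q) (pdA : pd_mx A) (m_gt0 : 0 < m).
Let psdA : psd_mx A := pd_psd A pdA.

Local Notation f := (fobj Q q).
Local Notation g := (gcon A v).
Local Notation gradJ := (grad_J Q A q v m).

Lemma fobj_convex y z : f y - f z <= dotv (grad_f Q q y) (y - z).
Proof.
have := psdQ.2 (y - z).
rewrite /fobj /grad_f mulmxDr mulmxN !dotvE (dotv_symmetric Q z y psdQ.1).
rewrite ![dotv (Q *m _) _]dotvC (dotv_symmetric Q z y psdQ.1); lra.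
Qed.

Lemma gcon_convex y z : g y - g z <= dotv (grad_g A v y) (y - z).
Proof.
have -> : y - z = (y - v) - (z - v) by rewrite opprB addrA subrK.
rewrite /gcon /grad_g; move: (y - v) (z - v) => a b.
have := psdA.2 (a - b).
rewrite mulmxDr mulmxN !dotvE (dotv_symmetric A b a psdA.1).
rewrite ![dotv (A *m _) _]dotvC (dotv_symmetric A b a psdA.1); lra.
Qed.

Lemma grad_J_gap k y z : (1 <= k)%N -> g y <= 1 -> g z <= 1 ->
  f y - f z - m / k%:R <= dotv (gradJ k y) (y - z).
Proof.
case: k => // p _ gy gz.
have gy01 := gcon_itv01 _ _ pdA y gy.
have /andP[g0 _] := gy01.
rewrite /grad_J /= dotvDl dotvZl.
have hf := fobj_convex y z; have hg := gcon_convex y z.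
have hp := exprn_ge0 p g0.
have h1 : g y ^+ p * (g y - 1) <= g y ^+ p * dotv (grad_g A v y) (y - z).
  by rewrite ler_wpM2l//; lra.
have h2 := exprn_gap_le p (g y) gy01.
move: h2; move: (p.+1%:R^-1) => c h2.
have h3 : - c <= g y ^+ p * dotv (grad_g A v y) (y - z) by lra.
have := ler_wpM2l (ltW m_gt0) h3; lra.
Qed.

(** Coercivity of [A] makes the ellipsoid bounded, and there the weight [g ^+ k.-1] is at most 1, so
    one constant serves every [k]. *)
Lemma grad_bounded : exists G : R, [/\ 0 <= G,
  forall y, g y <= 1 -> vnorm (grad_f Q q y) <= G &
  forall k y, (1 <= k)%N -> g y <= 1 -> vnorm (gradJ k y) <= G].
Proof.
have [K K0 hK] := pd_coercive A pdA.
have [KQ KQ0 hKQ] := vnorm_mulmx_bounded Q.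
have [KA KA0 hKA] := vnorm_mulmx_bounded A.
have hb y : g y <= 1 -> vnorm (y - v) <= 1 + K.
  move=> gy; rewrite -(@ler_pXn2r _ 2) ?nnegrE ?vnorm_ge0//; last by lra.
  apply: (le_trans (hK _)); rewrite -/(gcon A v y).
  have := ler_wpM2l (ltW K0) gy; nra.
pose F := KQ * (1 + K) + vnorm (Q *m v + q).
have F0 : 0 <= F by rewrite addr_ge0 ?vnorm_ge0// mulr_ge0; lra.
have hF y : g y <= 1 -> vnorm (grad_f Q q y) <= F.
  move=> /hb gy; have -> : grad_f Q q y = Q *m (y - v) + (Q *m v + q).
    by rewrite /grad_f mulmxBr addrA subrK.
  apply: (le_trans (vnormD _ _)); rewrite lerD2r; apply: (le_trans (hKQ _)).
  by rewrite ler_wpM2l// ltW.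
pose H := m * (2 * (KA * (1 + K))).
have H0 : 0 <= H by rewrite /H !mulr_ge0 ?addr_ge0// ltW.
exists (F + H); split; first by lra.
  by move=> y /hF; lra.
move=> [|p]// y _ gy; apply: (le_trans (vnormD _ _)); rewrite lerD ?hF//.
have /andP[g0 _] := gcon_itv01 _ _ pdA y gy.
have hp : g y ^+ p <= 1 by rewrite exprn_ile1.
have hp0 := exprn_ge0 p g0.
rewrite /grad_g !vnormZ normrM (gtr0_norm m_gt0) (ger0_norm hp0) ger0_norm// /H.
rewrite -mulrA ler_wpM2l ?(ltW m_gt0)// -[leRHS]mul1r ler_pM ?mulr_ge0 ?vnorm_ge0//.
rewrite ler_wpM2l//; apply: (le_trans (hKA _)).
by rewrite ler_wpM2l ?hb// ltW.
Qed.

End Convergence.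

Theorem theorem1 (R : realType) (n : nat) (Q A : 'M[R]_n) (q v : 'cV[R]_n) (m : R)
  (x : nat -> 'cV[R]_n) (gamma : nat -> R) :
  psd_mx Q -> pd_mx A -> 0 < m ->
  requirement2 Q A q v m ->
  gcon A v (x 1%N) <= 1 ->
  (forall k, (1 <= k)%N -> x k.+1 = x k - gamma k *: grad_J Q A q v m k (x k)) ->
  (forall k, (1 <= k)%N -> 0 < gamma k /\ gamma k <= (Lk Q A m k)^-1) ->
  cvg ((fun N => \sum_(1 <= k < N) gamma k ^+ 2) @ \oo) ->
  (fun N => \sum_(1 <= k < N) gamma k) @ \oo --> +oo ->
  forall xs : 'cV[R]_n, is_minimizer Q A q v xs ->
    (fun k => fobj Q q (x k)) @ \oo --> fobj Q q xs.
Proof.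
move=> psdQ pdA m0 req2 gx1 xS hgam cvg2 div xs [gxs fmin].
(* In dimension zero the space is a single point; the singular value estimates used below need a
   unit vector. *)
have [n0|n0] := leqP n 0.
  have x_eq k : x k = xs.
    by apply/matrixP => i; have := leq_trans (ltn_ord i) n0.
  rewrite (_ : (fun k => _) = (fun=> fobj Q q xs)); first exact: cvg_cst.
  by apply: funext => k; rewrite x_eq.
have feas k : (1 <= k)%N -> gcon A v (x k) <= 1.
  elim: k => // -[//|k] IH _; rewrite xS//.
  by have [? ?] := hgam k.+1 isT; apply: gradient_step_feasible; rewrite ?IH.
have [G [G0 hGf hGJ]] := grad_bounded Q A q v m pdA m0.
pose a k := fobj Q q (x k) - fobj Q q xs.
have a_ge0 k : (1 <= k)%N -> 0 <= a k by move=> k1; rewrite subr_ge0 fmin ?feas.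
have gam0 k : (1 <= k)%N -> 0 < gamma k by move=> /hgam[].
have [B hB] : exists B, forall N, \sum_(1 <= k < N) gamma k ^+ 2 <= B.
  pose u N := \sum_(1 <= k < N) gamma k ^+ 2.
  have u_nd : nondecreasing_seq u.
    apply/nondecreasing_seqP => -[|N]; first by rewrite /u !big_geq.
    by rewrite /u [leRHS]big_nat_recr//= lerDl sqr_ge0.
  by exists (limn u) => N; exact: (nondecreasing_cvgn_le u_nd cvg2).
(* Convexity is applied at the new point [x k.+1], which turns the increase of [f] into a product of
   two bounded gradients and the step size. *)
have a_step k : (1 <= k)%N -> a k.+1 <= a k + G ^+ 2 * gamma k.
  move=> k1; have := fobj_convex Q q psdQ (x k.+1) (x k).
  have -> : x k.+1 - x k = - (gamma k *: grad_J Q A q v m k (x k)).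
    by rewrite xS// addrAC subrr add0r.
  have := dotv_le_vnorm (grad_f Q q (x k.+1)) (- (gamma k *: grad_J Q A q v m k (x k))).
  rewrite vnormN vnormZ (gtr0_norm (gam0 k k1)) => h1 h2.
  have h3 : vnorm (grad_f Q q (x k.+1)) * (gamma k * vnorm (grad_J Q A q v m k (x k)))
      <= G * (gamma k * G).
    rewrite ler_pM ?vnorm_ge0 ?hGf ?feas//.
      by rewrite mulr_ge0 ?vnorm_ge0// ltW ?gam0.
    by rewrite ler_wpM2l ?hGJ ?feas// ltW ?gam0.
  rewrite /a; lra.
pose dist k := vnorm (x k - xs) ^+ 2.
(* The penalty error [2 * gamma k * m / k] is split by [2 s t <= s^2 + t^2] into [m * gamma k ^+ 2]
   and [m / k^2], both summable. *)
have dist_step k : (1 <= k)%N ->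
    2 * (gamma k * a k) + dist k.+1 <= dist k + (m + G ^+ 2) * gamma k ^+ 2
                                       + m * k%:R^-1 ^+ 2.
  move=> k1; rewrite /dist xS// addrAC.
  have gap : a k - m / k%:R <= dotv (grad_J Q A q v m k (x k)) (x k - xs).
    exact: grad_J_gap (feas k k1) gxs.
  have hJ := hGJ k (x k) k1 (feas k k1).
  move: (grad_J Q A q v m k (x k)) (x k - xs) gap hJ => J d gap hJ.
  have hJ2 : vnorm J ^+ 2 <= G ^+ 2 by rewrite ler_pXn2r ?nnegrE ?vnorm_ge0.
  move: hJ2; rewrite !sqr_vnorm !dotvE (dotvC d J) => hJ2.
  have gk := gam0 k k1.
  move: (k%:R^-1) gap => c gap.
  have h1 := ler_wpM2l (ltW gk) gap.
  have h2 := ler_wpM2l (sqr_ge0 (gamma k)) hJ2.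
  have h3 := ler_wpM2l (ltW m0) (sqr_ge0 (gamma k - c)).
  lra.
have telescope N : 2 * (\sum_(1 <= k < N.+1) gamma k * a k) + dist N.+1
    <= dist 1 + (m + G ^+ 2) * (\sum_(1 <= k < N.+1) gamma k ^+ 2)
       + m * (\sum_(1 <= k < N.+1) k%:R^-1 ^+ 2).
  elim: N => [|N IH]; first by rewrite !big_geq//; lra.
  by rewrite !(big_nat_recr N.+1)//=; have := dist_step N.+1 isT;
     move: (N.+1%:R^-1) => c; lra.
have hD N : \sum_(1 <= k < N) gamma k * a k
    <= (dist 1 + (m + G ^+ 2) * B + m * 2) / 2.
  have B0 : 0 <= B by have := hB 0%N; rewrite big_geq.
  have mG0 : 0 <= m + G ^+ 2 by rewrite addr_ge0 ?sqr_ge0// ltW.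
  case: N => [|N].
    rewrite big_geq// divr_ge0// !addr_ge0 ?sqr_ge0 ?mulr_ge0//; exact: ltW.
  have := telescope N; have := sqr_ge0 (vnorm (x N.+1 - xs)); rewrite -/(dist N.+1).
  have := ler_wpM2l mG0 (hB N.+1).
  have := ler_wpM2l (ltW m0) (@sum_inv_sqr_le2 R N.+1); lra.
have a_cvg : a @ \oo --> 0.
  apply: (cvg0_of_summable_steps a gamma (G ^+ 2) B _ (sqr_ge0 G) a_ge0 _ a_step hB hD div).
  by move=> k /gam0/ltW.
rewrite (_ : (fun k => _) = (fun k => a k + fobj Q q xs)); last first.
  by apply: funext => k; rewrite subrK.
by rewrite -[X in _ --> X]add0r; apply: cvgD => //; exact: cvg_cst.
Qed.
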